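(* Let $(w_n)_{n\ge0}$ be a decreasing sequence of positive real numbers with $w_n\to0$. Then there exist compact sets $K\subset\mathbb{T}$ of Lebesgue measure arbitrarily close to full (i.e. for every $\varepsilon>0$ there is such a $K$ with $m(K)>1-\varepsilon$) such that for every $\mu\in M(K)$, $$\sup\left\{\frac{|\widehat\mu(n)|}{w_n}:n=0,1,2,\dots\right\}<\infty\implies\mu\equiv0.$$
   Context: $\mathbb{T}$ is the unit circle and $m$ is normalized Lebesgue measure on $\mathbb{T}$. For a compact set $K\subset\mathbb{T}$, $M(K)$ is the space of complex finite Borel measures on $\mathbb{T}$ supported on $K$. The Fourier coefficients are $\widehat\mu(n)=\int_{\mathbb{T}}\zeta^{-n}\,d\mu(\zeta)$. *)

(* Defs.v *)
From HB Require Import structures.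
From mathcomp Require Import all_boot all_order all_algebra.
From mathcomp Require Import complex.
From mathcomp Require Import all_classical all_reals all_analysis.

Set Implicit Arguments.
Unset Strict Implicit.
Unset Printing Implicit Defensive.

Import Order.TTheory GRing.Theory Num.Theory.
Import numFieldNormedType.Exports.

Local Open Scope classical_set_scope.
Local Open Scope complex_scope.
Local Open Scope ring_scope.

Local Notation Re := complex.Re.
Local Notation Im := complex.Im.
(* The norm `|z| of z : R[i] lives in R[i]; cabs is the same number in R. *)
Notation cabs := (@Normc.normc _).

Section circle.
Variable R : realType.

Definition circle : Type := {z : R[i] | `|z| == 1}.

HB.instance Definition _ := Choice.on circle.

Lemma circle1_subproof : `|1 : R[i]| == 1. Proof. by rewrite normr1. Qed.

HB.instance Definition _ :=
  isPointed.Build circle (exist _ (1 : R[i]) circle1_subproof).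

Definition circle_coord (z : circle) : R * R := (Re (val z), Im (val z)).

HB.instance Definition _ :=
  Topological.copy circle (initial_topology circle_coord).

HB.instance Definition _ :=
  @isMeasurable.Build (sigma_display (@open circle)) circle
    <<s @open circle >> (@sigma_algebra0 _ setT (@open circle))
    (@sigma_algebraC _ (@open circle))
    (@sigma_algebra_bigcup _ setT (@open circle)).

Lemma cis_subproof (t : R) :
  `|(cos (2 * pi * t) +i* sin (2 * pi * t) : R[i])| == 1.
Proof. by rewrite normc_def /= cos2Dsin2 sqrtr1. Qed.

(* cis t = exp (2 i pi t) *)
Definition cis (t : R) : circle :=
  exist _ (cos (2 * pi * t) +i* sin (2 * pi * t)) (cis_subproof t).

(* Normalized Lebesgue measure: the image of Lebesgue measure on [0, 1]. *)
Definition circle_lebesgue (A : set circle) : \bar R :=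
  lebesgue_measure (`[0, 1] `&` cis @^-1` A).

End circle.

Section complex_measure.
Context d (T : measurableType d) (R : realType).

(* A charge being a finite signed measure, a complex (finite) measure is given
   by its real and imaginary parts. *)
Record complex_measure := ComplexMeasure {
  cmeasure_re : {charge set T -> \bar R} ;
  cmeasure_im : {charge set T -> \bar R} }.

Definition cmeasure (mu : complex_measure) (A : set T) : R[i] :=
  fine (cmeasure_re mu A) +i* fine (cmeasure_im mu A).

Definition supported_on (mu : complex_measure) (K : set T) : Prop :=
  forall A, measurable A -> A `&` K = set0 -> cmeasure mu A = 0.

(* Choice of a Hahn decomposition; the Jordan decomposition does not depend on
   it, by Hahn_decomposition_uniq. *)
Definition hahn_pos (nu : {charge set T -> \bar R}) : set T :=
  projT1 (cid (Hahn_decomposition nu)).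

Definition hahn_neg (nu : {charge set T -> \bar R}) : set T :=
  projT1 (cid (projT2 (cid (Hahn_decomposition nu)))).

Definition hahn_posneg (nu : {charge set T -> \bar R}) :
    hahn_decomposition nu (hahn_pos nu) (hahn_neg nu) :=
  projT2 (cid (projT2 (cid (Hahn_decomposition nu)))).

Definition charge_integral (nu : {charge set T -> \bar R}) (f : T -> R) : R :=
  (\int[jordan_pos (hahn_posneg nu)]_x f x
   - \int[jordan_neg (hahn_posneg nu)]_x f x)%R.

(* (int u dmu_re - int v dmu_im) + i (int u dmu_im + int v dmu_re)
   for f = u + i v and mu = mu_re + i mu_im *)
Definition cintegral (mu : complex_measure) (f : T -> R[i]) : R[i] :=
  let u x := Re (f x) in let v x := Im (f x) in
  (charge_integral (cmeasure_re mu) u - charge_integral (cmeasure_im mu) v)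
  +i* (charge_integral (cmeasure_im mu) u + charge_integral (cmeasure_re mu) v).

End complex_measure.
Arguments complex_measure {d} T R.

Definition fourier_coef (R : realType) (mu : complex_measure (circle R) R)
    (n : int) : R[i] :=
  cintegral mu (fun z => val z ^ (- n)).

(* Main.v *)
Require Import Defs.
From mathcomp Require Import all_boot all_order all_algebra.
From mathcomp Require Import complex ring lra zify.
From mathcomp Require Import all_classical all_reals all_analysis.
From mathcomp Require Import measurable_realfun.

Import Order.TTheory GRing.Theory Num.Theory.
Import numFieldNormedType.Exports.

(** The sets [K] are built so that, on [K], the constant function $1$ is a
    uniform limit of polynomials in $1/z$ whose frequencies are all large and
    whose coefficients are small against [w].

    For each $\delta, r > 0$ there is a polynomial $q$ with $q(0) = 1$ and
    $|q| \le \delta$ on the part of the circle at distance at least $r$ from $1$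
    ([small_polynomial]): take a high power of $1 + su$, where $u$ is the
    analytic half of a Fejér sum, so that $u(0) = 0$ and $\Re u \le -1$ away
    from $1$.  Composing with $z \mapsto z^{-M}$ spreads the exceptional arc
    into small arcs around the $M$-th roots of unity, of comparable total length
    whatever $M$ is, and leaves the coefficients unchanged.  Every frequency of
    $1 - q(z^{-M})$ is at least $M$, and since [w] tends to $0$ one can take $M$
    so large that [w], even evaluated $k$ places before $M$, beats the sum of
    the moduli of the coefficients ([gap_polynomial]).  Doing this with
    $\delta_k = 1/(k+1)$ and exceptional sets of summable small measure,
    [K] is the image in the circle of the parameters in $[0,1]$ that avoid all
    exceptional sets.

    Let $\mu$ be carried by [K] with $|\hat\mu(n)| \le C w_n$ for $n \ge 0$, and
    let $j$ be any integer, of either sign.  On [K] the functions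
    $z^j q_k(z^{-M_k})$ tend to $0$ uniformly, so their integrals do.  These
    integrals differ from $\int z^j\,d\mu$ by a combination of coefficients
    $\hat\mu(M_k i - j)$, $i \ge 1$, which for $k \ge j$ is at most $C/(k+1)$
    ([fourier_gap_le]).  Hence $\int z^j\,d\mu = 0$ for all integers $j$, in
    both directions although the hypothesis is one-sided
    ([decaying_measure_eq0]).

    It remains that such a measure vanishes ([complex_measure_uniqueness]).
    Trigonometric polynomials form an algebra, and the polynomials
    $(1-x^n)^{n2^n}$ converge boundedly on $[0,1]$ to the indicator of
    $x < 1/2$; composing and multiplying, the indicator of
    $\{\Re z < a, \Im z < b\}$ is a bounded limit of trigonometric polynomials,
    so these sets have measure zero.  They form a pi-system generating the
    Borel sets. *)

Set Implicit Arguments.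
Unset Strict Implicit.
Unset Printing Implicit Defensive.

Local Open Scope classical_set_scope.
Local Open Scope complex_scope.
Local Open Scope ring_scope.

Local Notation Re := complex.Re.
Local Notation Im := complex.Im.

(** * Modulus of complex numbers *)

Section modulus.
Variable R : realType.
Implicit Types x y z : R[i].

Lemma cabs_ge0 z : 0 <= cabs z.
Proof. by case: z => a b; exact: sqrtr_ge0. Qed.

Lemma cabs1 : cabs (1 : R[i]) = 1.
Proof. exact: (@Normc.normc1 R). Qed.

Lemma cabsM x y : cabs (x * y) = cabs x * cabs y.
Proof. exact: Normc.normcM. Qed.

Lemma cabsD_le x y : cabs (x + y) <= cabs x + cabs y.
Proof. exact: (@le_normcD R). Qed.

Lemma cabsN z : cabs (- z) = cabs z.
Proof. exact: (@normcN R). Qed.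

Lemma cabsX z n : cabs (z ^+ n) = cabs z ^+ n.
Proof. by elim: n => [|n IH]; rewrite ?expr0 ?cabs1// !exprS cabsM IH. Qed.

Lemma cabs_sqr z : cabs z ^+ 2 = Re z ^+ 2 + Im z ^+ 2.
Proof. by case: z => a b; rewrite /= sqr_sqrtr// addr_ge0// sqr_ge0. Qed.

Lemma normr_cabs z : `|z| = (cabs z)%:C.
Proof. by case: z. Qed.

Lemma Re_le_cabs z : `|Re z| <= cabs z.
Proof.
rewrite -(@ler_pXn2r _ 2) ?nnegrE ?cabs_ge0// cabs_sqr real_normK ?num_real//.
by rewrite lerDl sqr_ge0.
Qed.

Lemma Im_le_cabs z : `|Im z| <= cabs z.
Proof.
rewrite -(@ler_pXn2r _ 2) ?nnegrE ?cabs_ge0// cabs_sqr real_normK ?num_real//.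
by rewrite lerDr sqr_ge0.
Qed.

Lemma cabs_le_ReIm z : cabs z <= `|Re z| + `|Im z|.
Proof.
case: z => a b /=; rewrite -(@ler_pXn2r _ 2) ?nnegrE ?sqrtr_ge0 ?addr_ge0//.
rewrite sqr_sqrtr ?addr_ge0 ?sqr_ge0// sqrrD !real_normK ?num_real//.
by rewrite lerD2r lerDl mulrn_wge0// mulr_ge0.
Qed.

Lemma cabs_sum_le (I : Type) (r : seq I) (P : pred I) (F : I -> R[i]) :
  cabs (\sum_(i <- r | P i) F i) <= \sum_(i <- r | P i) cabs (F i).
Proof.
elim/big_ind2 : _ => [|x1 x2 y1 y2 h1 h2|//]; first by rewrite (Normc.normc0 R).
by rewrite (le_trans (cabsD_le _ _))// lerD.
Qed.

End modulus.

(** * Polynomials equal to 1 at the centre and small on most of the circle *)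

Section fejer.
Variable R : realType.
Implicit Types z : R[i].

(** The Dirichlet sum $1 + X + \dots + X^{n-1}$ in Horner form, so that
    $|D_{n+1}|^2 = |1 + z D_n|^2$ expands at once. *)
Fixpoint dirichlet (n : nat) : {poly R[i]} :=
  if n is m.+1 then 1 + 'X * dirichlet m else 0.

(** The positive-frequency half of $|D_n|^2$ on the circle: the sum of
    $X^{j-k}$ over $0 \le k < j < n$. *)
Definition fejer_half (n : nat) : {poly R[i]} :=
  \sum_(j < n) 'X * dirichlet j.

(** Up to the factor $n$ this is the Fejér kernel: nonnegative with mean $n$.
    Its two expressions, this one and [dirichlet_geom], bound the real part of
    [fejer_half] away from $1$. *)
Lemma cabs_dirichlet_sqr n z : cabs z = 1 ->
  cabs (dirichlet n).[z] ^+ 2 = n%:R + 2 * Re (fejer_half n).[z].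
Proof.
move=> z1; elim: n => [|n IH].
  by rewrite /fejer_half big_ord0 /= !horner0 /= mulr0 addr0 expr0n /= addr0 sqrtr0 expr0n.
have hz : cabs (z * (dirichlet n).[z]) ^+ 2 = cabs (dirichlet n).[z] ^+ 2.
  by rewrite cabsM z1 mul1r.
rewrite /fejer_half big_ord_recr /= -/(fejer_half n) !hornerE.
rewrite cabs_sqr -natr1; move: hz; rewrite IH cabs_sqr.
by case: ((fejer_half n).[z]) => a b; case: (z * _) => c d /=; lra.
Qed.

Lemma dirichlet_geom n z : (1 - z) * (dirichlet n).[z] = 1 - z ^+ n.
Proof.
elim: n => [|n IH]; first by rewrite /= horner0 mulr0 expr0 subrr.
rewrite /= !hornerE mulrDr mulr1 mulrCA IH exprS; ring.
Qed.

Lemma cabs_dirichlet_le n z : cabs z = 1 -> cabs (dirichlet n).[z] <= n%:R.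
Proof.
move=> z1; elim: n => [|n IH]; first by rewrite /= horner0 (Normc.normc0 R).
rewrite /= !hornerE (le_trans (cabsD_le _ _))// cabs1 cabsM z1 mul1r.
by rewrite -natr1 addrC lerD2r.
Qed.

Lemma cabs_fejer_half_le n z : cabs z = 1 ->
  cabs (fejer_half n).[z] <= (n * n)%:R.
Proof.
move=> z1; rewrite /fejer_half horner_sum (le_trans (cabs_sum_le _ _ _))//.
apply: (@le_trans _ _ (\sum_(j < n) n%:R)); last first.
  by rewrite sumr_const card_ord -mulrnA.
apply: ler_sum => j _; rewrite !hornerE cabsM z1 mul1r.
by rewrite (le_trans (cabs_dirichlet_le _ z1))// ler_nat ltnW.
Qed.

(** Off the arc, $|D_n| \le 2/r$ independently of $n$, so the mean wins in
    $2\Re u = |D_n|^2 - n$ once $n$ is large. *)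
Lemma Re_fejer_half_le (r : R) : 0 < r ->
  exists n, forall z, cabs z = 1 -> r <= cabs (1 - z) ->
    Re (fejer_half n).[z] <= -1.
Proof.
move=> r0; pose n := (Num.truncn (4 / r ^+ 2 + 2)).+1; exists n => z z1 rz.
have nge : 4 / r ^+ 2 + 2 < n%:R by exact: truncnS_gt.
have h1 : cabs (1 - z) * cabs (dirichlet n).[z] <= 2.
  rewrite -cabsM dirichlet_geom (le_trans (cabsD_le _ _))//.
  by rewrite cabsN cabs1 cabsX z1 expr1n -natr1.
have D0 := cabs_ge0 (dirichlet n).[z].
have h2 : r * cabs (dirichlet n).[z] <= 2.
  by rewrite (le_trans _ h1)// ler_wpM2r.
have h3 : cabs (dirichlet n).[z] ^+ 2 <= 4 / r ^+ 2.
  rewrite ler_pdivlMr ?exprn_gt0// mulrC -exprMn.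
  have -> : 4 = 2 ^+ 2 :> R by rewrite -natrX.
  by rewrite ler_pXn2r ?nnegrE ?mulr_ge0// ltW.
by move: h3; rewrite (cabs_dirichlet_sqr _ z1); lra.
Qed.

(** With $u$ an analytic polynomial vanishing at $0$ and $\Re u \le -1$ away
    from $1$, the value $1 + su$ at such points has modulus below $1$ for small
    $s > 0$, because $|1 + su|^2 = 1 + 2s\Re u + O(s^2)$; a high power of
    $1 + su$ is then small there and still equal to $1$ at $0$. *)
Lemma small_polynomial (r delta : R) : 0 < r -> 0 < delta ->
  exists q : {poly R[i]}, q.[0] = 1 /\
    forall z, cabs z = 1 -> r <= cabs (1 - z) -> cabs q.[z] <= delta.
Proof.
move=> r0 d0; have [n Ren] := Re_fejer_half_le r0.
pose B : R := (n * n)%:R + 1; pose s := B ^- 2.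
have B1 : 1 <= B by rewrite /B lerDr.
have B0 : 0 < B by rewrite (lt_le_trans ltr01).
have s0 : 0 < s by rewrite /s invr_gt0 exprn_gt0.
have s1 : s <= 1 by rewrite /s invf_le1 ?exprn_gt0// exprn_ege1.
pose p := 1 + s%:C *: fejer_half n.
have p0 : p.[0] = 1.
  rewrite /p !hornerE /fejer_half horner_sum big1 ?mulr0 ?addr0// => i _.
  by rewrite !hornerE ?mul0r.
have pz z : cabs z = 1 -> r <= cabs (1 - z) -> cabs p.[z] ^+ 2 <= 1 - s.
  move=> z1 rz; have := Ren z z1 rz; have := cabs_fejer_half_le n z1.
  rewrite /p !hornerE => h1 h2.
  have h3 : cabs (fejer_half n).[z] ^+ 2 <= B ^+ 2.
    rewrite ler_pXn2r ?nnegrE ?cabs_ge0 ?(ltW B0)//.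
    by rewrite (le_trans h1)// /B lerDl.
  have h4 : s ^+ 2 * cabs (fejer_half n).[z] ^+ 2 <= s.
    rewrite -[leRHS]mulr1 expr2 -mulrA ler_wpM2l ?(ltW s0)//.
    rewrite (@le_trans _ _ (s * B ^+ 2))// ?ler_wpM2l ?(ltW s0)//.
    by rewrite /s mulVf// expf_neq0// gt_eqF.
  move: h2 h4; rewrite !cabs_sqr.
  case: ((fejer_half n).[z]) => a b /= h2 h4.
  by rewrite !mul0r subr0 addr0 add0r; nra.
pose rho := Num.sqrt (1 - s).
have rho1 : `|rho| < 1.
  rewrite ger0_norm ?sqrtr_ge0// -sqrtr1 ltr_sqrt//; lra.
have [N hN] : exists N, rho ^+ N <= delta.
  have /cvgrPdist_le/(_ _ d0)[N _ /(_ N (leqnn N))] := cvg_expr rho1.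
  by rewrite sub0r normrN => h; exists N; rewrite (le_trans (ler_norm _)).
exists (p ^+ N); split; first by rewrite horner_exp p0 expr1n.
move=> z z1 rz; rewrite horner_exp cabsX (le_trans _ hN)//.
rewrite lerXn2r ?nnegrE ?cabs_ge0 ?sqrtr_ge0//.
rewrite -(@ler_pXn2r _ 2) ?nnegrE ?cabs_ge0 ?sqrtr_ge0//.
by rewrite sqr_sqrtr ?pz//; lra.
Qed.

End fejer.
(** * Integration of bounded functions against complex measures *)

Section bounded_measurable.
Context d (T : measurableType d) (R : realType).
Implicit Types (f g : T -> R) (h : T -> R[i]).

Definition bmeasurable f :=
  measurable_fun setT f /\ exists M : R, forall x, `|f x| <= M.

Definition cbmeasurable h :=
  bmeasurable (fun x => Re (h x)) /\ bmeasurable (fun x => Im (h x)).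

Lemma bmeasurable_cst (c : R) : bmeasurable (cst c).
Proof. by split; [exact: measurable_cst|exists `|c|]. Qed.

Lemma bmeasurableD f g : bmeasurable f -> bmeasurable g ->
  bmeasurable (fun x => f x + g x).
Proof.
move=> [mf [M hM]] [mg [N hN]]; split; first exact: measurable_funD.
by exists (M + N) => x; rewrite (le_trans (ler_normD _ _))// lerD.
Qed.

Lemma bmeasurableM f g : bmeasurable f -> bmeasurable g ->
  bmeasurable (fun x => f x * g x).
Proof.
move=> [mf [M hM]] [mg [N hN]]; split; first exact: measurable_funM.
by exists (M * N) => x; rewrite normrM ler_pM.
Qed.

Lemma bmeasurableZ (c : R) f : bmeasurable f -> bmeasurable (fun x => c * f x).
Proof. exact/bmeasurableM/bmeasurable_cst. Qed.

Lemma bmeasurableN f : bmeasurable f -> bmeasurable (fun x => - f x).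
Proof.
by move=> /(bmeasurableZ (-1)); under eq_fun do rewrite mulN1r.
Qed.

Lemma bmeasurable_integrable (mu : {finite_measure set T -> \bar R}) f :
  bmeasurable f -> mu.-integrable setT (EFin \o f).
Proof.
move=> [mf [M hM]].
apply: (le_integrable _ _ _ (finite_measure_integrable_cst mu M measurableT)).
- exact: measurableT.
- exact/measurable_EFinP.
- move=> x _ /=; rewrite lee_fin (le_trans (hM x))// ler_norm//.
Qed.

Lemma cbmeasurable_cst (c : R[i]) : cbmeasurable (cst c).
Proof. by split; exact: bmeasurable_cst. Qed.

Lemma cbmeasurableD h1 h2 : cbmeasurable h1 -> cbmeasurable h2 ->
  cbmeasurable (fun x => h1 x + h2 x).
Proof.
move=> [r1 i1] [r2 i2]; split.
- have -> : (fun x => Re (h1 x + h2 x)) = (fun x => Re (h1 x) + Re (h2 x)).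
    by apply/funext => x; case: (h1 x); case: (h2 x).
  exact: bmeasurableD.
- have -> : (fun x => Im (h1 x + h2 x)) = (fun x => Im (h1 x) + Im (h2 x)).
    by apply/funext => x; case: (h1 x); case: (h2 x).
  exact: bmeasurableD.
Qed.

Lemma cbmeasurableM h1 h2 : cbmeasurable h1 -> cbmeasurable h2 ->
  cbmeasurable (fun x => h1 x * h2 x).
Proof.
move=> [r1 i1] [r2 i2]; split.
- have -> : (fun x => Re (h1 x * h2 x)) =
      (fun x => Re (h1 x) * Re (h2 x) + - (Im (h1 x) * Im (h2 x))).
    by apply/funext => x; case: (h1 x); case: (h2 x).
  by apply: bmeasurableD; [|apply: bmeasurableN]; exact: bmeasurableM.
- have -> : (fun x => Im (h1 x * h2 x)) =
      (fun x => Re (h1 x) * Im (h2 x) + Im (h1 x) * Re (h2 x)).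
    by apply/funext => x; case: (h1 x); case: (h2 x).
  by apply: bmeasurableD; exact: bmeasurableM.
Qed.

Lemma cbmeasurableX h n : cbmeasurable h -> cbmeasurable (fun x => h x ^+ n).
Proof.
move=> bh; elim: n => [|n IH]; first exact: cbmeasurable_cst.
by under eq_fun do rewrite exprS; exact: cbmeasurableM.
Qed.

Lemma cbmeasurable_sum n (h : 'I_n -> T -> R[i]) :
  (forall i, cbmeasurable (h i)) -> cbmeasurable (fun x => \sum_(i < n) h i x).
Proof.
elim: n h => [|n IH] h bh.
  by under eq_fun do rewrite big_ord0; exact: cbmeasurable_cst.
under eq_fun do rewrite big_ord_recr.
by apply: cbmeasurableD => //; exact: IH.
Qed.

End bounded_measurable.

Section charge_integral.
Context d (T : measurableType d) (R : realType).
Implicit Types (nu : {charge set T -> \bar R}) (f g : T -> R) (K A : set T).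

Definition null_off (nu : {charge set T -> \bar R}) K :=
  forall A, measurable A -> A `&` K = set0 -> nu A = 0%E.

Lemma charge_integralD nu f g : bmeasurable f -> bmeasurable g ->
  charge_integral nu (fun x => f x + g x) =
  charge_integral nu f + charge_integral nu g.
Proof.
move=> bf bg; rewrite /charge_integral.
do 2 (rewrite RintegralD//; [|exact: bmeasurable_integrable..]).
by ring.
Qed.

Lemma charge_integralZ nu (c : R) f : bmeasurable f ->
  charge_integral nu (fun x => c * f x) = c * charge_integral nu f.
Proof.
move=> bf; rewrite /charge_integral.
do 2 (rewrite RintegralZl//; [|exact: bmeasurable_integrable..]).
by rewrite mulrBr.
Qed.

Lemma charge_integral0 nu : charge_integral nu (cst 0) = 0.
Proof.
have -> : cst 0 = (fun x => 0 * (cst 0 x : R)) :> (T -> R).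
  by apply/funext => x; rewrite mul0r.
by rewrite charge_integralZ ?mul0r//; exact: bmeasurable_cst.
Qed.

Lemma charge_integral_indic nu A : measurable A ->
  charge_integral nu (\1_A) = fine (nu A).
Proof.
move=> mA; rewrite /charge_integral /Rintegral !integral_indic// !setIT.
rewrite (jordan_decomp (hahn_posneg nu) mA) /cadd /= cscaleN1.
by rewrite fineD ?fineN// ?fin_numN; exact: fin_num_measure.
Qed.

(** Nullity outside [K] is a statement about all measurable sets there, hence
    about their intersections with the two Hahn sets. *)
Lemma jordan_null_off nu K : measurable K -> null_off nu K ->
  jordan_pos (hahn_posneg nu) (~` K) = 0%E /\
  jordan_neg (hahn_posneg nu) (~` K) = 0%E.
Proof.
move=> mK h; have [[mP _] [mN _] _ _] := hahn_posneg nu.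
have mKc := measurableC mK.
have h0 (X : set T) : measurable X -> nu (~` K `&` X) = 0%E.
  move=> mX; apply: h; first exact: measurableI.
  by rewrite setIAC setICl set0I.
split.
- by rewrite jordan_posE cjordan_posE /crestr0 mem_set// /crestr h0.
- by rewrite jordan_negE cjordan_negE /crestr0 mem_set// /crestr h0 ?oppe0.
Qed.

(** Dominated convergence, with bounds and limits required only on a set [K]
    carrying the measure: off [K], the polynomials $q_k(z^{-M_k})$ have no
    common bound. *)
Lemma Rintegral_dct (mu : {finite_measure set T -> \bar R}) K
    (f_ : nat -> T -> R) f (M : R) :
  measurable K -> mu (~` K) = 0%E ->
  (forall n, measurable_fun setT (f_ n)) -> measurable_fun setT f ->
  (forall n x, K x -> `|f_ n x| <= M) ->
  (forall x, K x -> f_ n x @[n --> \oo] --> f x) ->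
  \int[mu]_x f_ n x @[n --> \oo] --> \int[mu]_x f x.
Proof.
move=> mK K0 mf_ mf hM hf.
have aeK (P : T -> Prop) : (forall x, K x -> P x) -> {ae mu, forall x, P x}.
  move=> KP; exists (~` K); split => //; first exact: measurableC.
  by move=> x /= nPx Kx; apply/nPx/KP.
have [] := @dominated_convergence _ _ _ mu setT measurableT
  (fun n x => (f_ n x)%:E) (fun x => (f x)%:E) (fun x => (cst M x)%:E).
- by move=> n; exact/measurable_EFinP.
- exact/measurable_EFinP.
- apply: aeK => x Kx _; apply: cvg_EFin; last exact: hf.
  exact: nearW.
- exact: finite_measure_integrable_cst.
- by apply: aeK => x Kx n _; rewrite lee_fin hM.
move=> fi _ cv; apply: fine_cvg; rewrite fineK//.
exact: integrable_fin_num.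
Qed.

Lemma charge_integral_dct nu K (f_ : nat -> T -> R) f (M : R) :
  measurable K -> null_off nu K ->
  (forall n, measurable_fun setT (f_ n)) -> measurable_fun setT f ->
  (forall n x, K x -> `|f_ n x| <= M) ->
  (forall x, K x -> f_ n x @[n --> \oo] --> f x) ->
  charge_integral nu (f_ n) @[n --> \oo] --> charge_integral nu f.
Proof.
move=> mK /(jordan_null_off mK)[p0 n0] mf_ mf hM hf.
by apply: cvgB; apply: (@Rintegral_dct _ K _ _ M).
Qed.

Implicit Types (mu : complex_measure T R) (h : T -> R[i]).

Lemma cintegralD mu h1 h2 : cbmeasurable h1 -> cbmeasurable h2 ->
  cintegral mu (fun x => h1 x + h2 x) = cintegral mu h1 + cintegral mu h2.
Proof.
move=> [r1 i1] [r2 i2]; rewrite /cintegral.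
have -> : (fun x => Re (h1 x + h2 x)) = (fun x => Re (h1 x) + Re (h2 x)).
  by apply/funext => x; case: (h1 x); case: (h2 x).
have -> : (fun x => Im (h1 x + h2 x)) = (fun x => Im (h1 x) + Im (h2 x)).
  by apply/funext => x; case: (h1 x); case: (h2 x).
rewrite !charge_integralD//.
by apply/eqP; rewrite eq_complex /=; apply/andP; split; apply/eqP; ring.
Qed.

Lemma cintegralZ mu (c : R[i]) h : cbmeasurable h ->
  cintegral mu (fun x => c * h x) = c * cintegral mu h.
Proof.
case: c => a b [rh ih]; rewrite /cintegral.
have -> : (fun x => Re ((a +i* b) * h x)) =
    (fun x => a * Re (h x) + (- b) * Im (h x)).
  by apply/funext => x; case: (h x) => u v /=; rewrite mulNr.
have -> : (fun x => Im ((a +i* b) * h x)) =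
    (fun x => a * Im (h x) + b * Re (h x)).
  by apply/funext => x; case: (h x).
rewrite !(charge_integralD, charge_integralZ) //; try exact: bmeasurableZ.
by apply/eqP; rewrite eq_complex /=; apply/andP; split; apply/eqP; ring.
Qed.

Lemma cintegral_sum mu n (h : 'I_n -> T -> R[i]) :
  (forall i, cbmeasurable (h i)) ->
  cintegral mu (fun x => \sum_(i < n) h i x) = \sum_(i < n) cintegral mu (h i).
Proof.
elim: n h => [|n IH] h bh.
  rewrite big_ord0; under eq_fun do rewrite big_ord0.
  have := cintegralZ mu 0 (cbmeasurable_cst T 0).
  by rewrite mul0r; under eq_fun do rewrite mul0r.
rewrite big_ord_recr /=; under eq_fun do rewrite big_ord_recr.
rewrite cintegralD//; last by apply: cbmeasurable_sum.
by rewrite IH.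
Qed.

Lemma cintegral_dct0 mu K (h : nat -> T -> R[i]) (e : nat -> R) :
  measurable K -> null_off (cmeasure_re mu) K -> null_off (cmeasure_im mu) K ->
  (forall n, cbmeasurable (h n)) ->
  (forall n x, K x -> cabs (h n x) <= e n) -> e n @[n --> \oo] --> 0 ->
  cabs (cintegral mu (h n)) @[n --> \oo] --> 0.
Proof.
move=> mK Kre Kim mh hM e0.
have [M eM] : exists M, forall n, e n <= M.
  have /cvg_seq_bounded[M [_ /(_ (M + 1))]] : cvgn e by apply/cvg_ex; exists 0.
  rewrite ltrDl ltr01 => /(_ isT) eM.
  by exists (M + 1) => n; rewrite (le_trans (ler_norm _))// eM.
have cv nu (f : nat -> T -> R) : null_off nu K ->
    (forall n, bmeasurable (f n)) ->
    (forall n x, `|f n x| <= cabs (h n x)) ->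
    charge_integral nu (f n) @[n --> \oo] --> 0.
  move=> Knu mf fh; rewrite -(charge_integral0 nu).
  apply: (@charge_integral_dct _ K _ _ M) => //.
  - by move=> n; case: (mf n).
  - by move=> n x Kx; rewrite (le_trans (fh n x))// (le_trans (hM n x Kx)).
  - move=> x Kx; apply/norm_cvg0P.
    apply: (@squeeze_cvgr _ _ _ _ (cst 0) e); [|exact: cvg_cst|exact: e0].
    by apply: nearW => n; rewrite normr_ge0 /= (le_trans (fh n x)) ?hM.
have cre nu : null_off nu K ->
    charge_integral nu (fun x => Re (h n x)) @[n --> \oo] --> 0.
  move=> Knu; apply: cv => // [n|n x]; first by case: (mh n).
  exact: Re_le_cabs.
have cim nu : null_off nu K ->
    charge_integral nu (fun x => Im (h n x)) @[n --> \oo] --> 0.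
  move=> Knu; apply: cv => // [n|n x]; first by case: (mh n).
  exact: Im_le_cabs.
apply: (@squeeze_cvgr _ _ _ _ (cst 0)
  (fun n => `|Re (cintegral mu (h n))| + `|Im (cintegral mu (h n))|)).
- by apply: nearW => n; rewrite cabs_ge0 cabs_le_ReIm.
- exact: cvg_cst.
- rewrite -[X in _ --> X]addr0; apply: cvgD; apply/norm_cvg0P; rewrite /cintegral /=.
  + by rewrite -[X in _ --> X]subr0; apply: cvgB; [exact: cre|exact: cim].
  + by rewrite -[X in _ --> X]addr0; apply: cvgD; [exact: cre|exact: cim].
Qed.

End charge_integral.
(** * The circle as a topological and measurable space *)

Section circle.
Variable R : realType.
Implicit Types z : circle R.

Lemma cabs_val z : cabs (val z) = 1.
Proof.
case: z => z /= /eqP; rewrite normr_cabs => h.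
by apply: (@complexI R); rewrite h.
Qed.

Lemma circle_neq0 z : val z != 0.
Proof.
apply/eqP => z0; have := cabs_val z; rewrite z0 (Normc.normc0 R) => /eqP.
by rewrite eq_sym oner_eq0.
Qed.

Lemma circle_conj z : (val z)^*%C = (val z)^-1.
Proof.
apply: (mulfI (circle_neq0 z)); rewrite divff ?circle_neq0//.
by rewrite -sqr_normc normr_cabs cabs_val expr1n.
Qed.

Lemma cabs_circleXz z (n : int) : cabs (val z ^ n) = 1.
Proof.
by case: n => n; rewrite ?NegzE -?exprnN -?exprnP ?Normc.normcV cabsX cabs_val expr1n ?invr1.
Qed.

Lemma circle_Re_continuous : continuous (fun z => Re (val z)).
Proof.
move=> z.
have h : {for z, continuous (@circle_coord R)} by exact: initial_continuous.
exact: (cvg_comp _ fst h (@cvg_fst _ _ _ _ _)).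
Qed.

Lemma circle_Im_continuous : continuous (fun z => Im (val z)).
Proof.
move=> z.
have h : {for z, continuous (@circle_coord R)} by exact: initial_continuous.
exact: (cvg_comp _ snd h (@cvg_snd _ _ _ _ _)).
Qed.

(** Re and Im are continuous into a Hausdorff space and separate points. *)
Lemma circle_hausdorff : hausdorff_space (circle R).
Proof.
move=> p q pq.
have eqf (f : circle R -> R) : continuous f -> f p = f q.
  move=> cf; apply: (@Rhausdorff R) => A B Ap Bq.
  by have [x [Ax Bx]] := pq _ _ (cf p _ Ap) (cf q _ Bq); exists (f x).
apply/val_inj; have := eqf _ circle_Re_continuous.
have := eqf _ circle_Im_continuous.
by case: (val p) (val q) => a b [a' b'] /= -> ->.
Qed.

Lemma circle_open_measurable (U : set (circle R)) : open U -> measurable U.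
Proof. by move=> oU; exact: sub_sigma_algebra. Qed.

Lemma circle_continuous_measurable (f : circle R -> R) :
  continuous f -> measurable_fun setT f.
Proof.
move=> /continuousP cf; apply: (measurability _ (RGenOpens.measurableE R)).
move=> _ [_ [a [b ->] <-]]; rewrite setTI; apply: circle_open_measurable.
exact/cf/interval_open.
Qed.

Lemma cbmeasurable_val : cbmeasurable (fun z => val z).
Proof.
split; split.
- by apply: circle_continuous_measurable; exact: circle_Re_continuous.
- by exists 1 => z; rewrite (le_trans (Re_le_cabs _))// cabs_val.
- by apply: circle_continuous_measurable; exact: circle_Im_continuous.
- by exists 1 => z; rewrite (le_trans (Im_le_cabs _))// cabs_val.
Qed.

Lemma cbmeasurable_conj : cbmeasurable (fun z => (val z)^-1).
Proof.
under eq_fun do rewrite -circle_conj.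
have [re im] := cbmeasurable_val; split.
- by have -> : (fun z => Re (val z)^*%C) = (fun z => Re (val z)) by
    apply/funext => z; case: (val z).
- have -> : (fun z => Im (val z)^*%C) = (fun z => - Im (val z)).
    by apply/funext => z; case: (val z).
  exact: bmeasurableN.
Qed.

Lemma cbmeasurable_Xz (n : int) : cbmeasurable (fun z => val z ^ n).
Proof.
case: n => n; first exact: cbmeasurableX cbmeasurable_val.
under eq_fun do rewrite NegzE -exprnN -exprVn.
exact: cbmeasurableX cbmeasurable_conj.
Qed.

Definition corner (a b : R) : set (circle R) :=
  [set z | Re (val z) < a /\ Im (val z) < b].

Definition corners : set (set (circle R)) :=
  [set A | exists a b, A = corner a b].

Lemma corners_setI : setI_closed corners.
Proof.
move=> _ _ [a [b ->]] [a' [b' ->]]; exists (Num.min a a'), (Num.min b b').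
apply/seteqP; split => z; rewrite /corner /= !lt_min.
- by move=> [[-> ->] [-> ->]].
- by move=> [/andP[-> ->] /andP[-> ->]].
Qed.

Lemma corner_open a b : open (corner a b).
Proof.
rewrite (_ : corner a b = (fun z => Re (val z)) @^-1` [set x | x < a] `&`
  (fun z => Im (val z)) @^-1` [set x | x < b])//.
have /continuousP oRe := circle_Re_continuous.
have /continuousP oIm := circle_Im_continuous.
by apply: openI; [exact/oRe/open_lt|exact/oIm/open_lt].
Qed.

Definition box (i : rat * rat * rat * rat) : set (R * R) :=
  [set x | (ratr i.1.1.1 <= x.1 < ratr i.1.1.2) /\
           (ratr i.1.2 <= x.2 < ratr i.2)].

Lemma box_subset (V : set (R * R)) x : open V -> V x ->
  exists i, box i x /\ box i `<=` V.
Proof.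
move=> oV Vx; have /nbhs_ballP[e /= e0 eV] : nbhs x V by exact: open_nbhs_nbhs.
have rat_near (y : R) : exists a b : rat, ratr a <= y < ratr b /\
    forall t, ratr a <= t < ratr b -> `|y - t| < e.
  have [a] := @rat_in_itvoo R (y - e / 2) y ltac:(lra).
  have [b] := @rat_in_itvoo R y (y + e / 2) ltac:(lra).
  rewrite !in_itv /= => /andP[b1 b2] /andP[a1 a2]; exists a, b; split.
    by rewrite (ltW a2) b1.
  by move=> t /andP[t1 t2]; rewrite ltr_norml; apply/andP; split; lra.
have [a [b [h1 h2]]] := rat_near x.1; have [c [f [h3 h4]]] := rat_near x.2.
exists (a, b, c, f); split; first by split.
by move=> y [/= y1 y2]; apply: eV; split; [exact: h2|exact: h4].
Qed.

(** An open set of the plane is the union of the rational boxes it contains.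
    Half-open boxes are used because their preimages are differences of sets
    [Re z < a] and [Im z < b], which are corners: the other coordinate is
    always below [2]. *)
Lemma corners_generate : @measurable _ (circle R) = <<s corners >>.
Proof.
apply/seteqP; split; apply: smallest_sub; try exact: smallest_sigma_algebra;
  last first.
  move=> _ [a [b ->]]; apply: circle_open_measurable; exact: corner_open.
move=> U [V oV <-].
have mRe a : <<s corners >> [set z | Re (val z) < a].
  apply: sub_sigma_algebra; exists a, 2; apply/seteqP; split=> z /=; last by case.
  move=> za; split => //; have := Im_le_cabs (val z); rewrite cabs_val ler_norml.
  by move=> /andP[_ h]; rewrite (le_lt_trans h)// ltr1n.
have mIm a : <<s corners >> [set z | Im (val z) < a].
  apply: sub_sigma_algebra; exists 2, a; apply/seteqP; split=> z /=; last by case.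
  move=> za; split => //; have := Re_le_cabs (val z); rewrite cabs_val ler_norml.
  by move=> /andP[_ h]; rewrite (le_lt_trans h)// ltr1n.
pose T := g_sigma_algebraType corners.
have mbox i : @measurable _ T (@circle_coord R @^-1` box i).
  have -> : @circle_coord R @^-1` box i =
      ([set z | Re (val z) < ratr i.1.1.2] `\` [set z | Re (val z) < ratr i.1.1.1])
      `&` ([set z | Im (val z) < ratr i.2] `\` [set z | Im (val z) < ratr i.1.2]).
    apply/seteqP; split => z; rewrite /box /=.
    - by move=> [/andP[h1 ->] /andP[h2 ->]]; do !split => //; apply/negP; rewrite -leNgt.
    - by move=> [[-> /negP]] + [-> /negP]; rewrite -!leNgt => -> ->.
  by apply: (@measurableI _ T); apply: (@measurableD _ T);
    (exact: mRe || exact: mIm).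
have -> : @circle_coord R @^-1` V =
    \bigcup_i (@circle_coord R @^-1` (box i) `&` [set _ | box i `<=` V]).
  apply/seteqP; split => z /=.
  - by move=> /(box_subset oV)[i [h1 h2]]; exists i.
  - by move=> [i _ [h1 h2]]; exact: h2.
apply: (@countable_bigcupT_measurable _ T) => [|i]; first exact: countableP.
have [h|h] := pselect (box i `<=` V).
- have -> : [set _ : circle R | box i `<=` V] = setT by apply/seteqP; split.
  by rewrite setIT.
- have -> : [set _ : circle R | box i `<=` V] = set0 by apply/seteqP; split.
  by rewrite setI0; exact: (@measurable0 _ T).
Qed.

End circle.
(** * Uniqueness: a complex measure is determined by its Fourier coefficients *)

Section step.
Variable R : realType.

(** Polynomials in $x$ which on $[0,1]$ take values in $[0,1]$ and converge
    pointwise to the indicator of $x < 1/2$. *)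
Definition step_approx (n : nat) (x : R) : R := (1 - x ^+ n) ^+ (n * 2 ^ n).

Lemma bernoulli (t : R) m : 0 <= t <= 1 -> 1 - m%:R * t <= (1 - t) ^+ m.
Proof.
move=> /andP[t0 t1]; elim: m => [|m IH]; first by rewrite expr0 mul0r subr0.
rewrite exprS; apply: (@le_trans _ _ ((1 - t) * (1 - m%:R * t))).
  rewrite -natr1; have : 0 <= m%:R * t * t by rewrite !mulr_ge0.
  by lra.
by rewrite ler_wpM2l// subr_ge0.
Qed.

Lemma bernoulli_inv (t : R) m : 0 <= t <= 1 -> (1 + m%:R * t) * (1 - t) ^+ m <= 1.
Proof.
move=> /andP[t0 t1]; elim: m => [|m IH]; first by rewrite expr0 mul0r addr0 mulr1.
rewrite exprS mulrA (le_trans _ IH)// ler_wpM2r ?exprn_ge0 ?subr_ge0//.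
rewrite -natr1; have : 0 <= m%:R * t * t by rewrite !mulr_ge0.
by have := sqr_ge0 t; rewrite expr2; lra.
Qed.

(** With $s = \sqrt y$, $ny^n = (ns^n)s^n$ and $ns^n$ is bounded by the
    geometric sum. *)
Lemma natrM_expr_cvg0 (y : R) : 0 <= y < 1 -> n%:R * y ^+ n @[n --> \oo] --> 0.
Proof.
move=> /andP[y0 y1]; pose s := Num.sqrt y.
have s0 : 0 <= s by exact: sqrtr_ge0.
have s1 : s < 1 by rewrite -sqrtr1 ltr_sqrt.
have hs (n : nat) : n%:R * s ^+ n <= (1 - s)^-1.
  (* the n terms of the geometric sum 1 + s + ... are all at least s ^+ n *)
  rewrite -[leRHS]mul1r ler_pdivlMr ?subr_gt0//.
  have -> : n%:R * s ^+ n = \sum_(i < n) s ^+ n.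
    by rewrite sumr_const card_ord mulr_natl.
  apply: (@le_trans _ _ ((\sum_(i < n) s ^+ i) * (1 - s))).
    rewrite ler_wpM2r ?subr_ge0 ?(ltW s1)//; apply: ler_sum => i _.
    by rewrite ler_wiXn2l ?(ltW s1)// ltnW.
  by rewrite mulrC -opprB mulNr -subrX1 opprB gerBl exprn_ge0.
apply: (@squeeze_cvgr _ _ _ _ (cst 0) (fun n => (1 - s)^-1 * s ^+ n)).
- apply: nearW => n; rewrite mulr_ge0 ?exprn_ge0//=.
  by rewrite -(sqr_sqrtr y0) -/s expr2 exprMn mulrA ler_wpM2r ?exprn_ge0.
- exact: cvg_cst.
- rewrite -[X in _ --> X](mulr0 (1 - s)^-1); apply: cvgMr.
  by apply: cvg_expr; rewrite ger0_norm.
Qed.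

Lemma step_approx_itv n x : 0 <= x <= 1 -> 0 <= step_approx n x <= 1.
Proof.
move=> /andP[x0 x1]; have h0 : 0 <= 1 - x ^+ n by rewrite subr_ge0 exprn_ile1.
by rewrite exprn_ge0//= exprn_ile1// gerBl exprn_ge0.
Qed.

(** Bernoulli's inequality compares $(1-x^n)^m$ with $1 - mx^n$ and with
    $1/(1+mx^n)$.  For $m = n2^n$, $mx^n = n(2x)^n$ tends to $0$ if $x < 1/2$,
    and is at least $n$ otherwise: the factor $n$ settles the case $x = 1/2$. *)
Lemma step_approx_cvg (x : R) : 0 <= x <= 1 ->
  step_approx n x @[n --> \oo] --> ((x < 2^-1)%R%:R : R).
Proof.
move=> x01; have /andP[x0 x1] := x01.
have xn n : 0 <= x ^+ n <= 1 by rewrite exprn_ge0 //= exprn_ile1.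
have mE n : (n * 2 ^ n)%:R * x ^+ n = n%:R * (2 * x) ^+ n.
  by rewrite natrM natrX -mulrA exprMn.
case: ltP => hx.
- apply: (@squeeze_cvgr _ _ _ _ (fun n => 1 - n%:R * (2 * x) ^+ n) (cst 1)).
  + apply: nearW => n; have /andP[_ ->] := step_approx_itv n x01.
    by rewrite -mE /step_approx bernoulli.
  + rewrite -[X in _ --> X]subr0; apply: cvgB; first exact: cvg_cst.
    apply: natrM_expr_cvg0; rewrite mulr_ge0//=; lra.
  + exact: cvg_cst.
- apply: (@squeeze_cvgr _ _ _ _ (cst 0) (@harmonic R)).
  + apply: nearW => n; have /andP[h0 _] := step_approx_itv n x01; rewrite h0 /=.
    rewrite -[leRHS]mul1r ler_pdivlMr// mulrC.
    apply: (le_trans _ (@bernoulli_inv _ (n * 2 ^ n) (xn n))).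
    rewrite /step_approx ler_wpM2r// mE -natr1 addrC lerD2l ler_peMr// exprn_ege1//; lra.
  + exact: cvg_cst.
  + exact: cvg_harmonic.
Qed.

End step.

Section uniqueness.
Variable R : realType.
Implicit Types (z : circle R) (f g : circle R -> R).

(** A real trigonometric polynomial, written as a Laurent polynomial in $z$:
    sums and products of such functions are visibly of the same form. *)
Definition trigonometric f := exists (m : nat) (p : {poly R[i]}),
  forall z, (f z)%:C = val z ^- m * p.[val z].

Lemma trigonometric_cst (c : R) : trigonometric (cst c).
Proof. by exists 0%N, (c%:C)%:P => z; rewrite hornerC expr0 invr1 mul1r. Qed.

Lemma trigonometricD f g : trigonometric f -> trigonometric g ->
  trigonometric (fun z => f z + g z).
Proof.
move=> [m [p hp]] [n [q hq]]; exists (m + n)%N, ('X^n * p + 'X^m * q) => z.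
have z0 := circle_neq0 z; rewrite rmorphD /= hp hq !hornerE exprD.
move: (expf_neq0 m z0) (expf_neq0 n z0); move: (val z ^+ m) (val z ^+ n) => a b.
by move=> a0 b0; field; rewrite a0 b0.
Qed.

Lemma trigonometricM f g : trigonometric f -> trigonometric g ->
  trigonometric (fun z => f z * g z).
Proof.
move=> [m [p hp]] [n [q hq]]; exists (m + n)%N, (p * q) => z.
have z0 := circle_neq0 z; rewrite rmorphM /= hp hq hornerM exprD.
by rewrite invfM mulrACA.
Qed.

Lemma trigonometricX f n : trigonometric f -> trigonometric (fun z => f z ^+ n).
Proof.
move=> tf; elim: n => [|n IH]; first exact: trigonometric_cst.
by under eq_fun do rewrite exprS; exact: trigonometricM.
Qed.

Lemma trigonometricZ (c : R) f : trigonometric f -> trigonometric (fun z => c * f z).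
Proof. exact/trigonometricM/trigonometric_cst. Qed.

Lemma trigonometric_Re : trigonometric (fun z => Re (val z)).
Proof.
exists 1%N, (2^-1 *: ('X^2 + 1%:P)) => z; have z0 := circle_neq0 z.
by rewrite ReJ_add circle_conj !(hornerZ, hornerD, hornerXn, hornerC) expr1; field.
Qed.

Lemma trigonometric_Im : trigonometric (fun z => Im (val z)).
Proof.
exists 1%N, (('i%C / 2) *: (1%:P - 'X^2)) => z; have z0 := circle_neq0 z.
rewrite ImJ_sub circle_conj !(hornerZ, hornerD, hornerN, hornerXn, hornerC) expr1.
by field.
Qed.

Lemma trigonometric_step f n : trigonometric f ->
  trigonometric (fun z => step_approx n (f z)).
Proof.
move=> tf; apply: trigonometricX; apply: trigonometricD.
  exact: trigonometric_cst.
have -> : (fun z => - f z ^+ n) = (fun z => -1 * f z ^+ n).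
  by apply/funext => z; rewrite mulN1r.
exact/trigonometricZ/trigonometricX.
Qed.

Lemma trigonometric_sum f m (p : {poly R[i]}) :
  (forall z, (f z)%:C = val z ^- m * p.[val z]) ->
  (fun z => (f z)%:C) =
  (fun z => \sum_(i < size p) p`_i * val z ^ (i%:Z - m%:Z)).
Proof.
move=> hp; apply/funext => z; rewrite hp horner_coef mulr_sumr.
by apply: eq_bigr => i _; rewrite expfzDr ?circle_neq0// -exprnN -exprnP mulrCA [X in _ * X]mulrC.
Qed.

Lemma trigonometric_bmeasurable f : trigonometric f -> bmeasurable f.
Proof.
move=> [m [p /trigonometric_sum hp]].
suff [] : cbmeasurable (fun z => (f z)%:C) by [].
rewrite hp; apply: cbmeasurable_sum => i; apply: cbmeasurableM.
  exact: cbmeasurable_cst.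
exact: cbmeasurable_Xz.
Qed.

Variable mu : complex_measure (circle R) R.
Hypothesis mu0 : forall n : int, cintegral mu (fun z => val z ^ n) = 0.

Lemma trigonometric_charge_integral0 f : trigonometric f ->
  charge_integral (cmeasure_re mu) f = 0 /\
  charge_integral (cmeasure_im mu) f = 0.
Proof.
move=> [m [p /trigonometric_sum hp]].
have : cintegral mu (fun z => (f z)%:C) = 0.
  rewrite hp cintegral_sum => [|i]; last first.
    by apply: cbmeasurableM; [exact: cbmeasurable_cst|exact: cbmeasurable_Xz].
  apply: big1 => i _; rewrite cintegralZ ?mu0 ?mulr0//.
  exact: cbmeasurable_Xz.
rewrite /cintegral /= !charge_integral0 subr0 addr0 => /eqP.
by rewrite eq_complex /= => /andP[/eqP -> /eqP ->].
Qed.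

(** Rescales a coordinate in $[-1,1]$ to $[0,1]$ so that the threshold [a]
    becomes $1/2$. *)
Definition rescale (a x : R) : R := 2^-1 + (2 * (1 + `|a|))^-1 * (x - a).

Lemma rescale_itv a x : `|x| <= 1 -> 0 <= rescale a x <= 1.
Proof.
move=> x1; have c0 : 0 < 2 * (1 + `|a|) by rewrite mulr_gt0// ltr_pwDl.
suff : `|(2 * (1 + `|a|))^-1 * (x - a)| <= 2^-1.
  by rewrite ler_norml /rescale => /andP[h1 h2]; apply/andP; split; lra.
rewrite normrM ger0_norm ?invr_ge0 ?(ltW c0)// mulrC ler_pdivrMr// mulKf//.
by rewrite (le_trans (ler_normB _ _))// lerD2r.
Qed.

Lemma rescale_lt a x : (rescale a x < 2^-1) = (x < a).
Proof.
have c0 : 0 < (2 * (1 + `|a|))^-1 by rewrite invr_gt0 mulr_gt0// ltr_pwDl.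
by rewrite /rescale gtrDl pmulr_rlt0// subr_lt0.
Qed.

Lemma trigonometric_rescale a f : trigonometric f ->
  trigonometric (fun z => rescale a (f z)).
Proof.
move=> tf; apply: trigonometricD; first exact: trigonometric_cst.
apply: trigonometricZ; apply: trigonometricD => //; exact: trigonometric_cst.
Qed.

(** The indicator of a corner is a bounded pointwise limit of trigonometric
    polynomials, because [step_approx] turns them into such polynomials. *)
Lemma corner_charge0 (nu : {charge set (circle R) -> \bar R}) a b :
  (forall f, trigonometric f -> charge_integral nu f = 0) -> nu (corner a b) = 0%E.
Proof.
move=> nu0; have mc : measurable (corner a b).
  by apply: circle_open_measurable; exact: corner_open.
have re1 z : `|Re (val z)| <= 1 by rewrite (le_trans (Re_le_cabs _))// cabs_val.
have im1 z : `|Im (val z)| <= 1 by rewrite (le_trans (Im_le_cabs _))// cabs_val.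
pose F n z := step_approx n (rescale a (Re (val z))) *
              step_approx n (rescale b (Im (val z))).
have tF n : trigonometric (F n).
  by apply: trigonometricM; apply: trigonometric_step;
    apply: trigonometric_rescale; [exact: trigonometric_Re|exact: trigonometric_Im].
have cvF : charge_integral nu (F n) @[n --> \oo] -->
    charge_integral nu (\1_(corner a b)).
  apply: (@charge_integral_dct _ _ _ nu setT _ _ 1) => //.
  - by move=> A _; rewrite setIT => ->; rewrite charge0.
  - by move=> n; have [] := trigonometric_bmeasurable (tF n).
  - move=> n z _; rewrite normrM.
    have /andP[h1 h2] := @step_approx_itv R n _ (rescale_itv a (re1 z)).
    have /andP[h3 h4] := @step_approx_itv R n _ (rescale_itv b (im1 z)).
    by rewrite !ger0_norm// mulr_ile1.
  - move=> z _; rewrite (_ : \1_(corner a b) z =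
        (rescale a (Re (val z)) < 2^-1)%R%:R * (rescale b (Im (val z)) < 2^-1)%R%:R).
      by apply: cvgM; apply: step_approx_cvg; apply: rescale_itv.
    rewrite !rescale_lt indicE -natrM mulnb; congr ((nat_of_bool _)%:R).
    by apply/idP/idP => [/set_mem[-> ->]//|/andP[? ?]]; exact/mem_set.
move: cvF; under eq_fun do rewrite nu0//.
rewrite charge_integral_indic// => /cvg_lim; rewrite lim_cst// => h.
have finc : nu (corner a b) \is a fin_num by exact: fin_num_measure.
by rewrite -(fineK finc) -h.
Qed.

(** The pi-lambda theorem, the corners being a pi-system. *)
Lemma charge_determined_by_corners (nu : {charge set (circle R) -> \bar R}) :
  nu setT = 0%E -> (forall a b, nu (corner a b) = 0%E) ->
  forall A, measurable A -> nu A = 0%E.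
Proof.
move=> nuT nuc A; rewrite {1}corners_generate; move: A.
apply: (dynkin_induction (@corners_generate R) (@corners_setI R)) => //.
- by move=> _ [a [b ->]]; exact: nuc.
- move=> S mS S0; have := nuT; rewrite -(setUv S) chargeU ?setICr ?S0 ?add0e//.
  exact: measurableC.
- move=> F mF tF F0.
  have := @charge_semi_sigma_additive _ _ _ nu F mF tF (bigcup_measurable (fun n _ => mF n)).
  under eq_fun do rewrite big1//.
  by move=> /cvg_lim <-//; rewrite lim_cst.
Qed.

Theorem complex_measure_uniqueness A : measurable A -> cmeasure mu A = 0.
Proof.
have zero (nu : {charge set (circle R) -> \bar R}) :
    (forall f, trigonometric f -> charge_integral nu f = 0) ->
    forall B, measurable B -> nu B = 0%E.
  move=> nu0; apply: charge_determined_by_corners; last first.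
    by move=> a b; exact: corner_charge0.
  (* mass zero is the case of a corner containing the whole circle *)
  rewrite (_ : setT = corner 2 2); first exact: corner_charge0.
  apply/seteqP; split => // z _; have := cabs_val z.
  move: (Re_le_cabs (val z)) (Im_le_cabs (val z)) => + + z1.
  rewrite z1 !ler_norml => /andP[_ h1] /andP[_ h2].
  by split; rewrite (le_lt_trans _ (ltr1n R 2)).
move=> mA; rewrite /cmeasure !zero// => f tf.
- by case: (trigonometric_charge_integral0 tf).
- by case: (trigonometric_charge_integral0 tf).
Qed.

End uniqueness.
(** * The parametrization of the circle by the unit interval *)

Section cis.
Variable R : realType.
Implicit Types (s t : R).

Lemma cisD s t : val (cis (s + t)) = val (cis s) * val (cis t).
Proof.
by apply/eqP; rewrite eq_complex /= !mulrDr cosD sinD eqxx /= addrC eqxx.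
Qed.

Lemma cis0 : val (cis (0 : R)) = 1.
Proof. by rewrite /= mulr0 cos0 sin0. Qed.

Lemma cis_natM (n : nat) t : val (cis (n%:R * t)) = val (cis t) ^+ n.
Proof.
elim: n => [|n IH]; first by rewrite mul0r cis0 expr0.
by rewrite -natr1 mulrDl mul1r cisD IH exprSr.
Qed.

Lemma cis_nat (n : nat) : val (cis (n%:R : R)) = 1.
Proof.
rewrite -[n%:R]mulr1 cis_natM /= mulr1 mulr_natl cos2pi sin2pi.
exact: expr1n.
Qed.

Lemma cis_continuous : continuous (@cis R).
Proof.
apply/continuousP => _ [V oV <-].
rewrite (_ : _ @^-1` _ = (fun t => (cos (2 * pi * t), sin (2 * pi * t))) @^-1` V)//.
move: V oV; apply/continuousP => t.
have c : (2 * pi * s) @[s --> t] --> 2 * pi * t by apply: cvgMr; exact: cvg_id.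
have c1 : cos (2 * pi * s) @[s --> t] --> cos (2 * pi * t).
  by apply: (cvg_comp _ _ c); exact: continuous_cos.
have c2 : sin (2 * pi * s) @[s --> t] --> sin (2 * pi * t).
  by apply: (cvg_comp _ _ c); exact: continuous_sin.
exact: (cvg_pair c1 c2).
Qed.

(** The chord formula; both sides are compared through their squares. *)
Lemma cabs_1Bcis t : 0 <= t <= 1 -> cabs (1 - val (cis t)) = 2 * sin (pi * t).
Proof.
move=> /andP[t0 t1].
have s0 : 0 <= sin (pi * t).
  by apply: sin_ge0_pi; rewrite mulr_ge0 ?pi_ge0//= ler_piMr ?pi_ge0.
apply/eqP; rewrite -(@eqrXn2 _ 2) ?cabs_ge0 ?mulr_ge0// cabs_sqr /= exprMn.
rewrite -mulrA mulr_natl cos_mulr2n sin_mulr2n.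
have cs := cos2Dsin2 (pi * t); apply/eqP; rewrite ![_ *+ 2]mulr2n.
move: cs; move: (cos _) (sin _) => c s cs.
have {}cs : c ^+ 2 = 1 - s ^+ 2 by rewrite -cs addrK.
rewrite (_ : _ + _ = (2 - 2 * c ^+ 2) ^+ 2 + 4 * c ^+ 2 * s ^+ 2); last by ring.
by rewrite cs; ring.
Qed.

Lemma cis_away_from_1 (eta : R) : 0 < eta ->
  exists r, 0 < r /\
    forall t, eta <= t <= 1 - eta -> r <= cabs (1 - val (cis t)).
Proof.
move=> e0; have [e1|e1] := leP eta (1 - eta); last first.
  by exists 1; split => // t /andP[h1 h2]; exfalso; lra.
have [||c ci hc] := @EVT_min R (fun t => sin (pi * t)) eta (1 - eta) => //.
  apply: continuous_subspaceT => t; apply: (cvg_comp (fun t => pi * t) sin).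
    by apply: cvgMr; exact: cvg_id.
  exact: continuous_sin.
have /andP[c1 c2] : eta <= c <= 1 - eta by rewrite in_itv in ci.
exists (2 * sin (pi * c)); split.
  rewrite mulr_gt0// sin_gt0_pi// mulr_gt0 ?pi_gt0//=; last by lra.
  by rewrite gtr_pMr ?pi_gt0//; lra.
move=> t /andP[t1 t2]; rewrite cabs_1Bcis; last by apply/andP; split; lra.
by rewrite ler_pM2l// hc// in_itv /= t1 t2.
Qed.

(** $e^{2\pi i M t}$ depends only on the fractional part of $Mt$, which lies at
    distance at least [eta] from both $0$ and $1$. *)
Lemma cis_pow_away (eta r t : R) (M : nat) : 0 < eta ->
  (forall s, eta <= s <= 1 - eta -> r <= cabs (1 - val (cis s))) ->
  0 <= t <= 1 -> (forall j : nat, (j <= M)%N -> eta <= `|M%:R * t - j%:R|) ->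
  r <= cabs (1 - val (cis t) ^- M).
Proof.
move=> e0 hr /andP[t0 t1] hj.
have s0 : 0 <= M%:R * t by rewrite mulr_ge0.
have sM : M%:R * t <= M%:R by rewrite ler_piMr.
have /andP[j1 j2] := truncn_itv s0; set j := Num.truncn _ in j1 j2.
have jM : (j <= M)%N by rewrite -(ler_nat R) (le_trans j1).
have h1 := hj j jM.
(* the right endpoint t = 1 is excluded, as Mt = M is itself on the grid *)
have jltM : (j < M)%N.
  rewrite ltn_neqAle jM andbT; apply/eqP => jM'.
  by move: h1; rewrite jM' in j1 *; rewrite ger0_norm; lra.
have h2 := hj j.+1 jltM.
rewrite ger0_norm ?subr_ge0// in h1.
rewrite ltr0_norm ?subr_lt0// -natr1 in h2; rewrite -natr1 in j2.
(* 1 - 1/a = -(1 - a)/a has the modulus of 1 - a on the circle *)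
have -> : 1 - val (cis t) ^- M = - (1 - val (cis t) ^+ M) * val (cis t) ^- M.
  have := expf_neq0 M (circle_neq0 (cis t)); move: (_ ^+ M) => a a0.
  by rewrite mulNr mulrBl mul1r divff// opprB.
rewrite cabsM cabsN Normc.normcV [cabs (_ ^+ M)]cabsX cabs_val expr1n invr1 mulr1.
rewrite -cis_natM -[M%:R * t](subrK j%:R) cisD cis_nat mulr1.
by apply: hr; apply/andP; split; lra.
Qed.

(** Written as intervals in $t$ rather than as a condition on $Mt$, so that
    its measure is bounded by the sum of $M + 1$ lengths. *)
Definition near_grid (eta : R) (M : nat) : set R :=
  \bigcup_(j in `I_M.+1) `](j%:R - eta) / M%:R, (j%:R + eta) / M%:R[%classic.

Lemma near_gridN (eta t : R) (M : nat) : (0 < M)%N -> ~ near_grid eta M t ->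
  forall j : nat, (j <= M)%N -> eta <= `|M%:R * t - j%:R|.
Proof.
move=> M0 h j jM; rewrite leNgt; apply/negP => hj; apply: h.
exists j => //=.
rewrite in_itv /= ltr_pdivrMr ?ltr_pdivlMr ?ltr0n//.
by move: hj; rewrite ltr_norml => /andP[h1 h2]; apply/andP; split; lra.
Qed.

Lemma near_grid_open (eta : R) M : open (near_grid eta M).
Proof.
apply: bigcup_open => j _.
exact: interval_open.
Qed.

Lemma near_grid_measure (eta : R) (M : nat) : 0 < eta -> (0 < M)%N ->
  (lebesgue_measure (near_grid eta M) <= (4 * eta)%:E)%E.
Proof.
move=> e0 M0; have M0' : 0 < M%:R :> R by rewrite ltr0n.
rewrite /near_grid bigcup_mkord.
pose I (j : nat) : set R := `](j%:R - eta) / M%:R, (j%:R + eta) / M%:R[%classic.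
apply: (@le_trans _ _ (\sum_(j < M.+1) lebesgue_measure (I j))%E).
  by apply: (@Boole_inequality _ _ _ lebesgue_measure I) => j _; exact: measurable_itv.
rewrite (eq_bigr (fun=> (2 * eta / M%:R)%:E)) => [|j _]; last first.
  rewrite lebesgue_measure_itv /= lte_fin ltr_pM2r ?invr_gt0//.
  rewrite ltrD2l gtrN// -EFinB -mulrBl; congr (_ / _)%:E; lra.
rewrite sumEFin lee_fin sumr_const card_ord -[leLHS]mulr_natr -[leLHS]mulrA.
rewrite (_ : 4 * eta = 2 * eta * 2); last by ring.
rewrite ler_wpM2l ?mulr_ge0 ?(ltW e0)// mulrC ler_pdivrMr// -natrM ler_nat.
by rewrite mul2n -addnn -addn1 leq_add2l.
Qed.

End cis.
(** * The compact set *)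

Section gap_polynomials.
Variables (R : realType) (w : nat -> R).
Hypothesis w_decr : forall n, w n.+1 <= w n.
Hypothesis w_gt0 : forall n, 0 < w n.
Hypothesis w_cvg : w n @[n --> \oo] --> (0 : R).

Definition coef_norm (q : {poly R[i]}) : R := \sum_(i < size q) cabs q`_i.

(** Replacing $z$ by $z^{-M}$ keeps the size of the exceptional set and of the
    coefficients, and moves the nonzero frequencies to multiples of $M$,
    where [w] is as small as wanted. *)
Lemma gap_polynomial (eta delta : R) (k : nat) : 0 < eta -> 0 < delta ->
  exists qM : {poly R[i]} * nat,
    [/\ qM.1.[0] = 1, (0 < qM.2)%N, (k <= qM.2)%N,
        w (qM.2 - k)%N * coef_norm qM.1 <= delta
      & forall t, 0 <= t <= 1 -> ~ near_grid eta qM.2 t ->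
          cabs qM.1.[val (cis t) ^- qM.2] <= delta].
Proof.
move=> e0 d0; have [r [r0 hr]] := cis_away_from_1 e0.
have [q [q0 hq]] := small_polynomial r0 d0.
have S0 : 0 <= coef_norm q by apply: sumr_ge0 => i _; exact: cabs_ge0.
have dS : 0 < delta / (coef_norm q + 1) by rewrite divr_gt0// ltr_wpDl.
have /cvgrPdist_le/(_ _ dS)[N _ /(_ N (leqnn N))] := w_cvg.
rewrite sub0r normrN gtr0_norm// => hN.
exists (q, (N + k).+1); split => //; first by rewrite ltnW// ltnS leq_addl.
- rewrite [(_, _).1]/= [(_, _).2]/=.
  have wS : w ((N + k).+1 - k)%N <= w N.
    by rewrite subSn ?leq_addl// addnK.
  rewrite (le_trans (ler_wpM2r S0 (le_trans wS hN)))// -mulrA ler_piMr ?(ltW d0)//.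
  by rewrite ler_pdivrMl ?ltr_wpDl// mulr1 lerDl.
- move=> t t01 tN; apply: hq.
  + by rewrite Normc.normcV cabsX cabs_val expr1n invr1.
  + by apply: (cis_pow_away e0 hr t01); exact: near_gridN.
Qed.

(** In $z^j q(z^{-M})$ the terms other than $z^j$ itself have frequencies
    $j - Mi \le -(M - k)$, where the hypothesis on [mu] applies. *)
Lemma fourier_gap_le (mu : complex_measure (circle R) R) (C : R) (j : int)
    (k M : nat) (q : {poly R[i]}) :
  (forall n : nat, cabs (fourier_coef mu n%:Z) <= C * w n) -> 0 <= C ->
  q.[0] = 1 -> (j <= k%:Z) -> (k <= M)%N ->
  cabs (cintegral mu (fun z => val z ^ j)) <=
  cabs (cintegral mu (fun z => val z ^ j * q.[val z ^- M])) +
  C * (w (M - k)%N * coef_norm q).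
Proof.
move=> hC C0 q0 jk kM.
have w_anti m n : (m <= n)%N -> w n <= w m.
  by move=> mn; exact: ((nonincreasing_seqP w).1 w_decr).
have expand : (fun z : circle R => val z ^ j * q.[val z ^- M]) =
    (fun z => \sum_(i < size q) q`_i * val z ^ (j - (M * i)%:Z)).
  apply/funext => z; rewrite horner_coef mulr_sumr; apply: eq_bigr => i _.
  by rewrite expfzDr ?circle_neq0// -exprnN exprVn -exprM mulrCA.
have bm (i : 'I_(size q)) :
    cbmeasurable (fun z : circle R => q`_i * val z ^ (j - (M * i)%:Z)).
  by apply: cbmeasurableM; [exact: cbmeasurable_cst|exact: cbmeasurable_Xz].
rewrite expand cintegral_sum//.
have sq : (0 < size q)%N.
  by rewrite size_poly_gt0; apply/eqP => q00; move/eqP: q0; rewrite q00 horner0 eq_sym oner_eq0.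
have E0 : (fun z : circle R => q`_(Ordinal sq) * val z ^ (j - (M * Ordinal sq)%:Z)) =
    (fun z => val z ^ j).
  by apply/funext => z; rewrite /= muln0 subr0 -horner_coef0 q0 mul1r.
rewrite (bigD1 (Ordinal sq))// E0.
set A := cintegral _ _; set B := \sum_(i < _ | _) _.
have hB : cabs B <= C * (w (M - k)%N * coef_norm q).
  apply: (le_trans (cabs_sum_le _ _ _)).
  rewrite /coef_norm mulrA mulr_sumr big_mkcond; apply: ler_sum => i _.
  case: ifPn => i0; last by rewrite !mulr_ge0 ?cabs_ge0// ltW.
  rewrite cintegralZ; last exact: cbmeasurable_Xz.
  rewrite cabsM mulrC ler_wpM2r ?cabs_ge0//.
  have ipos : (0 < i)%N by rewrite lt0n; apply: contra i0 => /eqP i0; apply/eqP/val_inj.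
  have Mi : (M <= M * i)%N by rewrite leq_pmulr.
  have [n [nE Mn]] : exists n : nat, j - (M * i)%:Z = - n%:Z /\ (M - k <= n)%N.
    exists `|(M * i)%:Z - j|%N; lia.
  rewrite nE -/(fourier_coef mu n%:Z) (le_trans (hC n))// ler_wpM2l// w_anti//.
rewrite -[A in leLHS](addrK B) (le_trans (cabsD_le _ _))// cabsN lerD2l//.
Qed.

(** The harmonic bounds on [q k] give $\int z^j q_k(z^{-M_k})\,d\mu \to 0$ by
    dominated convergence on [K]; by [fourier_gap_le] this integral also
    approximates $\int z^j\,d\mu$. *)
Lemma decaying_measure_eq0 (K : set (circle R)) (q : nat -> {poly R[i]})
    (M : nat -> nat) (mu : complex_measure (circle R) R) (C : R) :
  measurable K ->
  (forall k, (q k).[0] = 1) -> (forall k, (k <= M k)%N) ->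
  (forall k, w (M k - k)%N * coef_norm (q k) <= k.+1%:R^-1) ->
  (forall k z, K z -> cabs (q k).[val z ^- M k] <= k.+1%:R^-1) ->
  supported_on mu K ->
  (forall n : nat, cabs (fourier_coef mu n%:Z) <= C * w n) -> 0 <= C ->
  forall A, measurable A -> cmeasure mu A = 0.
Proof.
move=> mK q0 kM wq qK muK hC C0.
apply: complex_measure_uniqueness => j.
have offre : null_off (cmeasure_re mu) K.
  move=> A mA AK; have /eqP := muK A mA AK; rewrite eq_complex /= => /andP[/eqP h _].
  by rewrite -(fineK (fin_num_measure (cmeasure_re mu) A mA)) h.
have offim : null_off (cmeasure_im mu) K.
  move=> A mA AK; have /eqP := muK A mA AK; rewrite eq_complex /= => /andP[_ /eqP h].
  by rewrite -(fineK (fin_num_measure (cmeasure_im mu) A mA)) h.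
pose h k (z : circle R) := val z ^ j * (q k).[val z ^- M k].
have cv : cabs (cintegral mu (h k)) @[k --> \oo] --> 0.
  apply: (@cintegral_dct0 _ _ _ _ K _ (@harmonic R)) => //.
  - move=> k; apply: cbmeasurableM; first exact: cbmeasurable_Xz.
    under eq_fun do rewrite horner_coef.
    apply: cbmeasurable_sum => i; apply: cbmeasurableM.
      exact: cbmeasurable_cst.
    by under eq_fun do rewrite -exprVn; do 2!apply: cbmeasurableX;
      exact: cbmeasurable_conj.
  - by move=> k z Kz; rewrite /h cabsM cabs_circleXz mul1r qK.
  - exact: cvg_harmonic.
apply: Normc.eq0_normc; apply/eqP; rewrite eq_le cabs_ge0 andbT.
have lim0 : cabs (cintegral mu (h k)) + C * k.+1%:R^-1 @[k --> \oo] --> 0.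
  rewrite -[X in _ --> X]addr0; apply: cvgD => //.
  rewrite -[X in _ --> X](mulr0 C); apply: cvgMr; exact: cvg_harmonic.
rewrite -(cvg_lim _ lim0)//; apply: limr_ge; first by apply/cvg_ex; exists 0.
exists `|j|%N => // k /= jk.
apply: (le_trans (fourier_gap_le hC C0 (q0 k) _ (kM k))); first by lia.
by rewrite lerD2l ler_wpM2l.
Qed.

End gap_polynomials.

Section good_parameters.
Variables (R : realType) (eps : R) (M : nat -> nat).
Hypothesis eps0 : 0 < eps.
Hypothesis M0 : forall k, (0 < M k)%N.

(** Chosen so that the measures of the exceptional sets, at most four times
    these numbers, add up to at most [eps / 2]. *)
Definition radius (k : nat) : R := eps / 8 / (2 ^ k.+1)%:R.

Lemma radius_gt0 k : 0 < radius k.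
Proof. by rewrite /radius !divr_gt0// ltr0n expn_gt0. Qed.

Definition good_parameters : set R :=
  `[0, 1]%classic `\` \bigcup_k near_grid (radius k) (M k).

Let bad : set R := \bigcup_k near_grid (radius k) (M k).

Let bad_open : open bad.
Proof. by apply: bigcup_open => k _; exact: near_grid_open. Qed.

Lemma good_parameters_compact : compact good_parameters.
Proof.
apply: (subclosed_compact _ (@segment_compact R 0 1)); last exact: subIsetl.
by apply: closedI; [exact: interval_closed|exact: open_closedC].
Qed.

Lemma good_parameters_measure :
  ((1 - eps)%:E < lebesgue_measure good_parameters)%E.
Proof.
have mbad : measurable bad by exact: open_measurable.
have hbad : (lebesgue_measure bad <= (eps / 2)%:E)%E.
  apply: (@le_trans _ _ (\sum_(k <oo) lebesgue_measure (near_grid (radius k) (M k)))%E).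
    apply: generalized_Boole_inequality => // k; apply: open_measurable.
    exact: near_grid_open.
  apply: (@le_trans _ _ (\sum_(k <oo) (eps / 2 / (2 ^ k.+1)%:R)%:E)%E).
    apply: lee_nneseries => // k _.
    rewrite (le_trans (near_grid_measure (radius_gt0 k) (M0 k)))// lee_fin.
    by rewrite /radius !mulrA ler_wpM2r ?invr_ge0//; lra.
  by apply: epsilon_trick0; rewrite divr_ge0// ltW.
pose J : set R := `[0, 1]%classic.
have h1 : lebesgue_measure J = 1%:E.
  by rewrite /J lebesgue_measure_itv /= lte_fin ltr01 oppr0 adde0.
have finJ : (lebesgue_measure J < +oo)%E by rewrite h1 ltry.
have -> : lebesgue_measure good_parameters =
    (1%:E - lebesgue_measure (J `&` bad))%E.
  by rewrite -h1; apply: measureD => //; exact: finJ.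
apply: (@lt_le_trans _ _ (1%:E - (eps / 2)%:E)%E).
  by rewrite -EFinB lte_fin ltrD2l ltrN2 gtr_pMr// invf_lt1// ltr1n.
rewrite leeB// (le_trans _ hbad)// le_measure ?inE//.
by apply: measurableI => //; exact: measurable_itv.
Qed.

End good_parameters.

Theorem theorem2p8 (R : realType) (w : nat -> R)
    (w_decr : forall n, w n.+1 <= w n) (w_gt0 : forall n, 0 < w n)
    (w_cvg : w n @[n --> \oo] --> (0 : R)) :
  forall eps : R, 0 < eps ->
  exists K : set (circle R),
    [/\ compact K,
        ((1 - eps)%:E < circle_lebesgue K)%E
      & forall mu : complex_measure (circle R) R, supported_on mu K ->
          (ereal_sup [set (cabs (fourier_coef mu n%:Z) / w n)%:E | n in [set: nat]]
             < +oo)%E ->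
          forall A : set (circle R), measurable A -> cmeasure mu A = 0].
Proof.
move=> eps eps0.
have /choice[qM hqM] (k : nat) := gap_polynomial w_decr w_gt0 w_cvg k
  (radius_gt0 eps0 k) (ltac:(by rewrite invr_gt0) : 0 < k.+1%:R^-1 :> R).
pose M k := (qM k).2.
have M0 k : (0 < M k)%N by case: (hqM k).
pose G := good_parameters eps M.
pose K : set (circle R) := [set cis t | t in G].
have cK : compact K.
  apply: continuous_compact; last exact: good_parameters_compact.
  by apply: continuous_subspaceT; exact: cis_continuous.
have clK : closed K by exact: compact_closed (@circle_hausdorff R) cK.
exists K; split => //.
- apply: (lt_le_trans (good_parameters_measure eps0 M0)).
  rewrite /circle_lebesgue le_measure ?inE//.
  + apply: measurableD => //; apply: open_measurable.
    by apply: bigcup_open => k _; exact: near_grid_open.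
  + apply: measurableI => //; apply: closed_measurable.
    by apply: closed_comp clK => t _; exact: cis_continuous.
  + by move=> t Gt; split; [case: Gt|exists t].
- move=> mu muK decay.
  set S := [set _ | _ in _] in decay.
  have Sfin n : exists2 c : R, ereal_sup S = c%:E &
      cabs (fourier_coef mu n%:Z) / w n <= c.
    have : ((cabs (fourier_coef mu n%:Z) / w n)%:E <= ereal_sup S)%E.
      by apply: ereal_sup_ubound; exists n.
    by case: (ereal_sup S) decay => // c _; rewrite lee_fin => h; exists c.
  have [C supC hC0] := Sfin 0%N.
  apply: (@decaying_measure_eq0 _ w w_decr w_gt0 K (fun k => (qM k).1) M mu C) => //.
  + by rewrite -[K]setCK; apply: measurableC; apply: circle_open_measurable; exact: closed_openC.
  + by move=> k; case: (hqM k).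
  + by move=> k; case: (hqM k).
  + by move=> k; case: (hqM k).
  + move=> k z [t [t01 tbad] <-]; have [_ _ _ _] := hqM k; apply.
      by move: t01; rewrite /= in_itv.
    by move=> tk; apply: tbad; exists k.
  + move=> n; have [c] := Sfin n; rewrite supC => -[<-].
    by rewrite ler_pdivrMr.
  + by rewrite (le_trans _ hC0)// divr_ge0 ?cabs_ge0// ltW.
Qed.
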